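(* Let $(\mathcal A,\varphi)$ be a probability space, let $\rho:\mathbb B_\infty\to\mathrm{Aut}(\mathcal A,\varphi)$ be a representation, let $\mathcal C_0$ be a $\varphi$-conditioned von Neumann subalgebra of $\mathcal A$ with $\mathcal C_0\subset\mathcal A_0^\rho$, and let $\mathscr I_{\mathcal C_0}$ be the braidable random sequence given by $\iota_0=\mathrm{id}|_{\mathcal C_0}$ and $\iota_n=\rho(\sigma_n\sigma_{n-1}\cdots\sigma_1)\iota_0$ for $n\ge1$, with tail algebra $\mathcal C^{\mathrm{tail}}:=\bigcap_{n\ge0}\bigvee_{k\ge n}\iota_k(\mathcal C_0)$. Then $$\mathcal C^{\mathrm{tail}}\subset\mathcal A^{\rho(\mathbb B_\infty)}.$$ Suppose in addition that $\mathcal A^{\rho(\mathbb B_\infty)}\subset\mathcal C_0$. Then $$\mathcal C^{\mathrm{tail}}=\mathcal A^{\rho(\mathbb B_\infty)}.$$ In particular, these two algebras are trivial (equal to $\mathbb C\mathbf 1$) if the random sequence $\mathscr I_{\mathcal C_0}$ is order $\mathbb C$-independent.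
   Context: A probability space $(\mathcal A,\varphi)$ is a von Neumann algebra $\mathcal A$ with separable predual together with a faithful normal state $\varphi$. A von Neumann subalgebra $\mathcal B\subset\mathcal A$ is $\varphi$-conditioned if the $\varphi$-preserving conditional expectation of $\mathcal A$ onto $\mathcal B$ exists. $\bigvee$ denotes the von Neumann algebra generated; $\mathrm{Aut}(\mathcal A,\varphi)$ is the group of $\varphi$-preserving automorphisms of $\mathcal A$; $\mathbb N_0=\{0,1,2,\dots\}$. $\mathbb B_\infty$ is generated by $\sigma_1,\sigma_2,\dots$ subject to $\sigma_i\sigma_j\sigma_i=\sigma_j\sigma_i\sigma_j$ if $|i-j|=1$ and $\sigma_i\sigma_j=\sigma_j\sigma_i$ if $|i-j|>1$. $\mathcal A^{\rho(\sigma_n)}$ is the fixed point algebra of $\rho(\sigma_n)$ in $\mathcal A$, $\mathcal A^{\rho(\mathbb B_\infty)}$ is the fixed point algebra of $\rho(\mathbb B_\infty)$, and $\mathcal A_0^\rho:=\bigcap_{n\ge2}\mathcal A^{\rho(\sigma_n)}$. The random sequence is order $\mathbb C$-independent if $\varphi(xy)=\varphi(x)\varphi(y)$ for all $x\in\bigvee_{i\in I}\iota_i(\mathcal C_0)$, $y\in\bigvee_{j\in J}\iota_j(\mathcal C_0)$ and all $I,J\subset\mathbb N_0$ with $I<J$ or $I>J$ (where $I<J$ means $i<j$ for all $i\in I$, $j\in J$). *)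

(* Defs.v *)
From HB Require Import structures.
From mathcomp Require Import all_boot all_order all_algebra generic_quotient complex.
From mathcomp Require Import all_classical all_reals all_analysis.

Set Implicit Arguments.
Unset Strict Implicit.
Unset Printing Implicit Defensive.

Import Order.TTheory GRing.Theory Num.Theory numFieldNormedType.Exports.

Local Open Scope classical_set_scope.
Local Open Scope ring_scope.
Local Open Scope quotient_scope.

(* A letter (i, true) stands for sigma_(i+1) and (i, false) for its inverse. *)
Definition braid_word : Type := seq (nat * bool).

Inductive braid_eq : braid_word -> braid_word -> Prop :=
| braid_eq_refl u : braid_eq u u
| braid_eq_sym u v : braid_eq u v -> braid_eq v u
| braid_eq_trans u v w : braid_eq u v -> braid_eq v w -> braid_eq u w
| braid_eq_cat u u' v v' :
    braid_eq u u' -> braid_eq v v' -> braid_eq (u ++ v) (u' ++ v')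
| braid_eq_cancel i b : braid_eq [:: (i, b); (i, ~~ b)] [::]
| braid_eq_adjacent i :
    braid_eq [:: (i, true); (i.+1, true); (i, true)]
             [:: (i.+1, true); (i, true); (i.+1, true)]
| braid_eq_distant i j : (i.+1 < j)%N ->
    braid_eq [:: (i, true); (j, true)] [:: (j, true); (i, true)].

Definition braid_eqb (u v : braid_word) : bool := `[< braid_eq u v >].

Lemma braid_eqb_equiv : equiv_class_of braid_eqb.
Proof.
split=> [u|u v|v u w]; first by apply/asboolP; exact: braid_eq_refl.
  by apply/asboolP/asboolP; exact: braid_eq_sym.
by move=> /asboolP uv /asboolP vw; apply/asboolP; exact: braid_eq_trans uv vw.
Qed.

Canonical braid_eqb_rel := EquivRelPack braid_eqb_equiv.

Definition braid_group : Type := {eq_quot braid_eqb}.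
HB.instance Definition _ := Choice.on braid_group.

Definition to_braid (u : braid_word) : braid_group := \pi_({eq_quot braid_eqb}) u.

Lemma to_braidP u v : to_braid u = to_braid v <-> braid_eq u v.
Proof. by split=> [/eqmodP/asboolP|uv]; last by apply/eqmodP/asboolP. Qed.

Lemma braid_reprP u : braid_eq (repr (to_braid u)) u.
Proof. by apply/to_braidP; rewrite /to_braid reprK. Qed.

Definition inv_word (u : braid_word) : braid_word :=
  rev [seq (x.1, ~~ x.2) | x <- u].

Lemma inv_wordK : involutive inv_word.
Proof.
move=> u; rewrite /inv_word map_rev revK -map_comp.
by apply: map_id_in => -[i b] _ /=; rewrite negbK.
Qed.

Lemma inv_word_cat u v : inv_word (u ++ v) = inv_word v ++ inv_word u.
Proof. by rewrite /inv_word map_cat rev_cat. Qed.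

Lemma braid_eq_catV u : braid_eq (u ++ inv_word u) [::].
Proof.
elim: u => [|[i b] u IH]; first exact: braid_eq_refl.
rewrite -cat1s inv_word_cat catA -(catA _ u).
apply: braid_eq_trans (braid_eq_cancel i b).
rewrite -[X in braid_eq _ X]/([:: (i, b)] ++ [::] ++ [:: (i, ~~ b)]) -catA.
apply: braid_eq_cat; first exact: braid_eq_refl.
by apply: braid_eq_cat => //; exact: braid_eq_refl.
Qed.

Lemma braid_eq_Vcat u : braid_eq (inv_word u ++ u) [::].
Proof. by have := braid_eq_catV (inv_word u); rewrite inv_wordK. Qed.

Definition braid_one : braid_group := to_braid [::].
Definition braid_mul (g h : braid_group) : braid_group :=
  to_braid (repr g ++ repr h).
Definition braid_inv (g : braid_group) : braid_group :=
  to_braid (inv_word (repr g)).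

Lemma to_braid_repr g : to_braid (repr g) = g.
Proof. exact: reprK. Qed.

Lemma braid_mulE u v : braid_mul (to_braid u) (to_braid v) = to_braid (u ++ v).
Proof. by apply/to_braidP; apply: braid_eq_cat; exact: braid_reprP. Qed.

Lemma braid_mulA : associative braid_mul.
Proof.
move=> x y z; rewrite -(to_braid_repr x) -(to_braid_repr y) -(to_braid_repr z).
by rewrite !braid_mulE catA.
Qed.

Lemma braid_1mul : left_id braid_one braid_mul.
Proof. by move=> x; rewrite -(to_braid_repr x) braid_mulE. Qed.

Lemma braid_mul1 : right_id braid_one braid_mul.
Proof. by move=> x; rewrite -(to_braid_repr x) braid_mulE cats0. Qed.

Lemma braid_Vmul : left_inverse braid_one braid_inv braid_mul.
Proof.
move=> x; rewrite -{2}(to_braid_repr x) braid_mulE.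
by apply/to_braidP; exact: braid_eq_Vcat.
Qed.

Lemma braid_mulV : right_inverse braid_one braid_inv braid_mul.
Proof.
move=> x; rewrite -{1}(to_braid_repr x) braid_mulE.
by apply/to_braidP; exact: braid_eq_catV.
Qed.

HB.instance Definition _ :=
  isGroup.Build braid_group
    braid_mulA braid_1mul braid_mul1 braid_Vmul braid_mulV.

(* sigma n is the Artin generator sigma_n for n >= 1; sigma 0 is never used. *)
Definition sigma (n : nat) : braid_group := to_braid [:: (n.-1, true)].

(* sigma_n sigma_(n-1) ... sigma_1 *)
Fixpoint sigma_desc (n : nat) : braid_group :=
  if n is m.+1 then (sigma m.+1 * sigma_desc m)%g else 1%g.

(* Giving R[i] the type numClosedFieldType lets the norm topology be found. *)
Definition Cplx (R : realType) : numClosedFieldType := R[i]%C.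

(* The inner product is linear in its first argument. *)
Record hilbertSpace (R : realType) := HilbertSpace {
  hilbert_sort :> completeNormedModType (Cplx R);
  inner : {dot hilbert_sort for Num.conj};
  inner_norm : forall u : hilbert_sort, `|u| ^+ 2 = inner u u
}.

Section VonNeumann.
Context {R : realType} {H : hilbertSpace R}.
Local Notation C := (Cplx R).
Local Notation op := (H -> H).
Local Notation "''[' u , v ]" := (@inner R H u v).
Implicit Types (x y : op) (S M N A B : set op) (phi : op -> C).

Definition bounded_op x : Prop := linear x /\ continuous x.

Definition adjoint_op x y : Prop := forall u v, '[x u, v] = '[u, y v].

Definition positive_op x : Prop := forall u, 0 <= '[x u, u].

Definition commutant S : set op :=
  [set x | bounded_op x /\ forall s, S s -> x \o s = s \o x].

Record star_subalgebra M : Prop := StarSubalgebra {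
  star_bounded : forall x, M x -> bounded_op x;
  star_id : M idfun;
  star_linear : forall (c : C) x y, M x -> M y -> M (c *: x + y);
  star_comp : forall x y, M x -> M y -> M (x \o y);
  star_adjoint : forall x, M x -> exists2 y, M y & adjoint_op x y
}.

Definition von_neumann_algebra M : Prop :=
  star_subalgebra M /\ commutant (commutant M) = M.

Definition vN_generated S : set op :=
  \bigcap_(N in [set N | von_neumann_algebra N /\ S `<=` N]) N.

Definition linear_on M {V : lmodType C} (f : op -> V) : Prop :=
  forall (c : C) x y, M x -> M y -> f (c *: x + y) = c *: f x + f y.

Definition square_summable (xi : nat -> H) : Prop :=
  cvgn (series (fun n => `|xi n| ^+ 2)).

(* The sigma-weakly continuous functionals, i.e. the elements of the predual:
   f x = \sum_n <x xi_n, eta_n> with square-summable xi and eta. *)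
Definition normal_functional M (f : op -> C) : Prop :=
  exists xi eta : nat -> H, [/\ square_summable xi, square_summable eta &
    forall x, M x -> series (fun n => '[x (xi n), eta n]) @ \oo --> f x].

(* Separability is for the norm of the predual as a subspace of the dual. *)
Definition separable_predual M : Prop :=
  exists F : nat -> op -> C,
    (forall n, normal_functional M (F n)) /\
    forall f, normal_functional M f -> forall e : C, 0 < e ->
      exists n, forall x, M x -> (forall u, `|x u| <= `|u|) ->
        `|f x - F n x| <= e.

Record faithful_normal_state M phi : Prop := FaithfulNormalState {
  state_linear : linear_on M (phi : op -> C^o);
  state_positive : forall x, M x -> positive_op x -> 0 <= phi x;
  state_unit : phi idfun = 1;
  state_normal : normal_functional M phi;
  state_faithful : forall x, M x -> positive_op x -> phi x = 0 -> x = 0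
}.

Definition probability_space A phi : Prop :=
  [/\ von_neumann_algebra A, separable_predual A & faithful_normal_state A phi].

Record conditional_expectation A B (E : op -> op) : Prop :=
  ConditionalExpectation {
  cond_exp_into : forall x, A x -> B (E x);
  cond_exp_linear : linear_on A E;
  cond_exp_id : forall b, B b -> E b = b;
  cond_exp_positive : forall x, A x -> positive_op x -> positive_op (E x);
  cond_exp_bimodule : forall b x b', B b -> A x -> B b' ->
    E (b \o x \o b') = b \o E x \o b'
}.

Definition conditioned A phi B : Prop :=
  [/\ von_neumann_algebra B, B `<=` A &
      exists2 E, conditional_expectation A B E &
                 forall x, A x -> phi (E x) = phi x].

(* Only the values of alpha on A matter. *)
Record automorphism A phi (alpha : op -> op) : Prop := Automorphism {
  aut_bij : set_bij A A alpha;
  aut_linear : linear_on A alpha;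
  aut_comp : forall x y, A x -> A y -> alpha (x \o y) = alpha x \o alpha y;
  aut_adjoint : forall x y, A x -> A y -> adjoint_op x y ->
    adjoint_op (alpha x) (alpha y);
  aut_state : forall x, A x -> phi (alpha x) = phi x
}.

Definition braid_representation A phi (rho : braid_group -> op -> op) : Prop :=
  (forall g, automorphism A phi (rho g)) /\
  (forall g h x, A x -> rho (g * h)%g x = rho g (rho h x)).

Definition fixed_points A (alpha : op -> op) : set op :=
  [set x | A x /\ alpha x = x].

Definition braid_fixed A (rho : braid_group -> op -> op) : set op :=
  [set x | A x /\ forall g, rho g x = x].

Definition braid_A0 A (rho : braid_group -> op -> op) : set op :=
  \bigcap_(n in [set n | (2 <= n)%N]) fixed_points A (rho (sigma n)).

Definition braid_sequence (rho : braid_group -> op -> op) (n : nat) : op -> op :=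
  if n is 0 then id else rho (sigma_desc n).

Section RandomSequence.
Variables (iota_ : nat -> op -> op) (C0 : set op).

Definition seq_algebra (I : set nat) : set op :=
  vN_generated (\bigcup_(i in I) (iota_ i @` C0)).

Definition tail_algebra : set op :=
  \bigcap_n seq_algebra [set k | (n <= k)%N].

Definition set_before (I J : set nat) : Prop :=
  forall i j, I i -> J j -> (i < j)%N.

Definition order_independent phi : Prop :=
  forall I J : set nat, set_before I J \/ set_before J I ->
  forall x y, seq_algebra I x -> seq_algebra J y ->
    phi (x \o y) = phi x * phi y.

End RandomSequence.

Definition scalar_ops : set op := range (fun c : C => c *: (idfun : op)).

End VonNeumann.

(* Main.v *)
From HB Require Import structures.
Require Import Defs.
From mathcomp Require Import all_boot all_order all_algebra complex.
From mathcomp Require Import all_classical all_reals all_analysis.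
From mathcomp Require Import ring lra.
Set Implicit Arguments.
Unset Strict Implicit.
Unset Printing Implicit Defensive.
Import Order.TTheory GRing.Theory Num.Theory numFieldNormedType.Exports.
Local Open Scope classical_set_scope.
Local Open Scope ring_scope.

(** The image of [C0] under the n-th embedding is fixed by [sigma_m] as soon as
    1 <= m < n: by the braid relations, [sigma_m (sigma_n ... sigma_1)] equals
    [(sigma_n ... sigma_1) sigma_(m+1)], and [sigma_(m+1)] fixes [C0]
    ([braid_sequence_fixed]). Hence [sigma_m] fixes the generators of the
    algebra of the embeddings of index greater than m. The fixed point algebra
    of [rho (sigma_m)] is a von Neumann algebra ([fixed_points_vN]), so it
    contains the whole generated algebra, and an element of the tail algebra is
    fixed by every [sigma_m], hence by the braid group.

    That the fixed points form a von Neumann algebra, i.e. that they equal their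
    bicommutant, is where the analysis lies. Von Neumann's density theorem
    ([bicommutant_density]) approximates an element of the bicommutant by fixed
    points in the seminorm given by the normal state; invariance and
    faithfulness of the state conclude. The density theorem takes place in the
    Hilbert space of square-summable sequences of vectors and rests on the
    orthogonal projection on the closure of a subspace ([projects_to_exists]).

    If [C0] contains the fixed points of the braid group, then a fixed point is
    its own image under every embedding, so it lies in the tail algebra. Under
    order independence, a fixed point [y] and its adjoint lie in the algebras
    over two index sets in increasing order, so [phi (y* y) = phi y* phi y]. For
    [y = x - phi x] this is zero, and faithfulness makes [x] a scalar. *)

(** * Complex scalars and their real parts *)

Section RealPart.
Context {R : realType}.
Implicit Types (z w : Cplx R) (r s : R).

Definition re z : R := complex.Re z.

(** A constant of its own, so that limits of its values are taken in the norm
    topology of [Cplx R]. *)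
Definition toC r : Cplx R := real_complex R r.

Lemma reD z w : re (z + w) = re z + re w.
Proof. by case: z w => [a b] [c d]. Qed.

Lemma reN z : re (- z) = - re z.
Proof. by case: z. Qed.

Lemma re0 : re 0 = 0.
Proof. by []. Qed.

Lemma re_sum (I : Type) (s : seq I) (P : pred I) (F : I -> Cplx R) :
  re (\sum_(i <- s | P i) F i) = \sum_(i <- s | P i) re (F i).
Proof. by apply: (big_morph re reD re0). Qed.

Lemma re_conj z : re z^* = re z.
Proof. by case: z. Qed.

Lemma toCK r : re (toC r) = r. Proof. by []. Qed.

Lemma re_toCM r z : re (toC r * z) = r * re z.
Proof. by case: z => a b; rewrite /re /= mul0r subr0. Qed.

Lemma reK z : z \is Num.real -> toC (re z) = z.
Proof. exact: RRe_real. Qed.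

Lemma toC_ge0 r : (0 <= toC r) = (0 <= r).
Proof. exact: ler0c. Qed.

Lemma toC_gt0 r : (0 < toC r) = (0 < r).
Proof. exact: (ltcR 0 r). Qed.

Lemma toC_le r s : (toC r <= toC s) = (r <= s).
Proof. exact: lecR. Qed.

Lemma toC_lt r s : (toC r < toC s) = (r < s).
Proof. exact: ltcR. Qed.

Lemma re_ge0 z : 0 <= z -> 0 <= re z.
Proof. by move=> z0; rewrite -toC_ge0 reK// ger0_real. Qed.

Lemma re_gt0 z : 0 < z -> 0 < re z.
Proof. by move=> z0; rewrite -toC_gt0 reK// gtr0_real. Qed.

Definition toC_additive : {additive R -> Cplx R} := real_complex R.

Lemma toCM r s : toC (r * s) = toC r * toC s.
Proof. exact: (rmorphM (real_complex R)). Qed.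

Lemma toC_sum (I : Type) (s : seq I) (P : pred I) (F : I -> R) :
  toC (\sum_(i <- s | P i) F i) = \sum_(i <- s | P i) toC (F i).
Proof. exact: (raddf_sum toC_additive). Qed.

Lemma re_le_norm z : `|re z| <= re `|z|.
Proof.
by rewrite -toC_le reK ?normr_real//; exact: normc_ge_Re.
Qed.

Lemma re_norm_toC r : re `|toC r| = `|r|.
Proof.
by rewrite normc_def /= expr0n addr0 sqrtr_sqr.
Qed.

Lemma cvg_re (f : nat -> Cplx R) z : f @ \oo --> z -> (re \o f) @ \oo --> re z.
Proof.
move=> fz; apply/cvgrPdist_lt => e e0; have ce0 : 0 < toC e by rewrite toC_gt0.
move/(@cvgrPdist_lt (Cplx R)): fz => /(_ _ ce0); apply: filterS => n.
rewrite -[`|_|]reK ?normr_real// toC_lt /= -reN -reD.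
exact: le_lt_trans (re_le_norm _).
Qed.

Lemma cvg_toC (f : nat -> R) r : f @ \oo --> r -> (toC \o f) @ \oo --> toC r.
Proof.
move=> fr; apply/(@cvgrPdist_lt (Cplx R)) => e e0.
move/cvgrPdist_lt: fr => /(_ _ (re_gt0 e0)); apply: filterS => n.
rewrite -re_norm_toC -toC_lt (reK (gtr0_real e0)) (reK (normr_real _)).
by rewrite [toC _](raddfB toC_additive).
Qed.

Definition sqmod z : R := re z ^+ 2 + complex.Im z ^+ 2.

Lemma sqmodE z : toC (sqmod z) = z * z^*.
Proof.
by case: z => a b; rewrite /sqmod /toC /re /=; congr Complex; ring.
Qed.

Lemma sqmod_ge0 z : 0 <= sqmod z.
Proof. by rewrite addr_ge0// sqr_ge0. Qed.

Lemma sqmod_eq0 z : sqmod z <= 0 -> z = 0.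
Proof.
move=> z0; have /eqP : sqmod z = 0 by apply/eqP; rewrite eq_le z0 sqmod_ge0.
rewrite paddr_eq0 ?sqr_ge0// !sqrf_eq0 /re; case: z {z0} => a b /=.
by move=> /andP[/eqP -> /eqP ->].
Qed.

Lemma sqmod0 : sqmod 0 = 0. Proof. by rewrite /sqmod /re /= expr0n addr0. Qed.

Lemma sqmod_toCM r z : sqmod (toC r * z) = r ^+ 2 * sqmod z.
Proof. by case: z => a b; rewrite /sqmod /re /=; ring. Qed.

Lemma conj_toCM r z : (toC r * z)^* = toC r * z^*.
Proof. by rewrite rmorphM; congr (_ * _); exact: conjc_real. Qed.

Lemma sqmodD_le z w : sqmod (z + w) <= 2 * sqmod z + 2 * sqmod w.
Proof.
case: z w => [a b] [c d]; rewrite /sqmod /re /=.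
have := sqr_ge0 (a - c); have := sqr_ge0 (b - d); nra.
Qed.

(** The form in which the approximation arguments below are concluded. *)
Lemma small_le0 (x B : R) : 0 <= B ->
  (forall e, 0 < e -> x <= B * e) -> x <= 0.
Proof.
move=> B0 xB; rewrite leNgt; apply/negP => x0.
have B1 : 0 < B + 1 by lra.
have /xB : 0 < x / (2 * (B + 1)) by rewrite divr_gt0// mulr_gt0.
rewrite mulrA ler_pdivlMr ?mulr_gt0//; nra.
Qed.

End RealPart.

(** * Orthogonal projections in complete inner product spaces *)

Section DotProduct.
Context {R : realType} {V : lmodType (Cplx R)}.
Variable ip : {dot V for Num.conj}.
Implicit Types (u v w k p : V) (c : Cplx R) (K : set V).

Definition sqnorm v : R := re (ip v v).

Lemma ipC u v : ip u v = (ip v u)^*.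
Proof. by rewrite hermC expr0 mul1r. Qed.

Lemma ipDl u v w : ip (u + v) w = ip u w + ip v w.
Proof. exact: linearDl. Qed.

Lemma ipZl c u w : ip (c *: u) w = c * ip u w.
Proof. exact: linearZl_LR. Qed.

Lemma ipDr u v w : ip u (v + w) = ip u v + ip u w.
Proof. exact: linearDr. Qed.

Lemma ipZr c u w : ip u (c *: w) = c^* * ip u w.
Proof. exact: linearZr_LR. Qed.

Lemma ipNl u w : ip (- u) w = - ip u w.
Proof. exact: linearNl. Qed.

Lemma ipNr u w : ip u (- w) = - ip u w.
Proof. exact: linearNr. Qed.

Lemma ip0l w : ip 0 w = 0.
Proof. exact: linear0l. Qed.

Lemma ip0r w : ip w 0 = 0.
Proof. exact: linear0r. Qed.

Lemma ip_ge0 v : 0 <= ip v v.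
Proof.
have [->|v0] := eqVneq v 0; first by rewrite ip0l.
exact/ltW/neq0_dnorm_gt0.
Qed.

Lemma ipvv v : ip v v = toC (sqnorm v).
Proof. by rewrite reK// ger0_real// ip_ge0. Qed.

Lemma sqnorm_ge0 v : 0 <= sqnorm v.
Proof. by rewrite re_ge0// ip_ge0. Qed.

Lemma sqnorm_eq0 v : sqnorm v <= 0 -> v = 0.
Proof.
move=> v0; apply/eqP/negP => /negP /(neq0_dnorm_gt0 (s := ip)) /re_gt0.
by rewrite ltNge v0.
Qed.

Lemma sqnormD u v : sqnorm (u + v) = sqnorm u + sqnorm v + 2 * re (ip u v).
Proof.
by rewrite /sqnorm ipDl !ipDr !reD (ipC v u) re_conj; ring.
Qed.

Lemma sqnormN v : sqnorm (- v) = sqnorm v.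
Proof. by rewrite /sqnorm ipNl ipNr opprK. Qed.

Lemma sqnormBC u v : sqnorm (u - v) = sqnorm (v - u).
Proof. by rewrite -sqnormN opprB. Qed.

Lemma sqnormB u v : sqnorm (u - v) = sqnorm u + sqnorm v - 2 * re (ip u v).
Proof. by rewrite sqnormD sqnormN ipNr reN mulrN. Qed.

Lemma sqnormZ c v : sqnorm (c *: v) = sqmod c * sqnorm v.
Proof. by rewrite /sqnorm ipZl ipZr mulrA -sqmodE re_toCM. Qed.

Lemma sqnormD_le u v : sqnorm (u + v) <= 2 * sqnorm u + 2 * sqnorm v.
Proof. have := sqnorm_ge0 (u - v); rewrite sqnormB sqnormD; lra. Qed.

Lemma ip_ext u v : (forall w, ip u w = ip v w) -> u = v.
Proof.
move=> uv; apply/eqP; rewrite -subr_eq0; apply/eqP/sqnorm_eq0.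
by rewrite /sqnorm ipDl ipNl uv subrr.
Qed.

(** Subtracting a multiple of [k] from [w] can lower its squared norm by
    [sqmod (ip w k) / sqnorm k], at [c = ip w k / sqnorm k]; so a vector whose
    squared norm is almost minimal modulo a subspace is almost orthogonal to
    it. With [d = 0] this is the Cauchy-Schwarz inequality. *)
Lemma near_orthogonal w k d : (forall c, d <= sqnorm (w - c *: k)) ->
  sqmod (ip w k) <= (sqnorm w - d) * sqnorm k.
Proof.
move=> dle; set s := ip w k.
have [k0|k0] := leP (sqnorm k) 0.
  by rewrite /s (sqnorm_eq0 k0) /sqnorm !ip0r sqmod0 re0 mulr0.
have := dle (toC (sqnorm k)^-1 * s).
rewrite sqnormB ipZr conj_toCM sqnormZ -/s -mulrA (mulrC s^*) -sqmodE.
rewrite re_toCM toCK sqmod_toCM.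
set t := sqmod s; set a := sqnorm k in k0 *; set b := sqnorm w => h.
have : d <= b - t / a.
  apply: le_trans h _; rewrite le_eqVlt; apply/orP; left; apply/eqP.
  by field; lra.
by rewrite -(ler_pdivrMr _ _ k0); lra.
Qed.

Lemma cauchy_schwarz u v : sqmod (ip u v) <= sqnorm u * sqnorm v.
Proof.
rewrite -[sqnorm u]subr0; apply: near_orthogonal => c; exact: sqnorm_ge0.
Qed.

Definition dot_cauchy (x : nat -> V) : Prop := forall e : R, 0 < e ->
  exists N : nat,
    forall i j, (N <= i)%N -> (N <= j)%N -> sqnorm (x i - x j) <= e.

Definition dot_cvg (x : nat -> V) (l : V) : Prop := forall e : R, 0 < e ->
  exists N : nat, forall i, (N <= i)%N -> sqnorm (x i - l) <= e.

Definition dot_complete : Prop :=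
  forall x, dot_cauchy x -> exists l, dot_cvg x l.

(** Closure for the norm of [ip], phrased with the squared norm so that [V] can
    be any left module, without a topology. *)
Definition dot_closure K : set V :=
  [set p | forall e : R, 0 < e -> exists2 k, K k & sqnorm (p - k) <= e].

Definition subspace K : Prop :=
  K 0 /\ forall c u v, K u -> K v -> K (c *: u + v).

Lemma dot_closure_subspace K : subspace K -> subspace (dot_closure K).
Proof.
move=> [K0 KD]; split=> [e e0|c p q Kp Kq e e0].
  by exists 0 => //; rewrite subrr /sqnorm ip0l ltW.
have B0 : 0 < 2 * sqmod c + 2 by have := sqmod_ge0 c; lra.
have d0 : 0 < e / (2 * sqmod c + 2) by rewrite divr_gt0.
have [k Kk pk] := Kp _ d0; have [l Kl ql] := Kq _ d0.
exists (c *: k + l); first exact: KD.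
rewrite opprD addrACA -scalerBr.
apply: le_trans (sqnormD_le _ _) _; rewrite sqnormZ.
move: pk ql; rewrite !ler_pdivlMr//; have := sqmod_ge0 c.
have := sqnorm_ge0 (p - k); have := sqnorm_ge0 (q - l).
set s := sqmod c; set a := sqnorm _; set b := sqnorm _.
nra.
Qed.

(** [p] is the orthogonal projection of [v] on the closure of [K]. *)
Definition projects_to K v p : Prop :=
  dot_closure K p /\ forall k, K k -> ip (v - p) k = 0.

Lemma orthogonal_closure K w p : (forall k, K k -> ip w k = 0) ->
  dot_closure K p -> ip w p = 0.
Proof.
move=> wK Kp; apply/sqmod_eq0/(small_le0 (sqnorm_ge0 w)) => e /Kp[k Kk pk].
have -> : ip w p = ip w (p - k) by rewrite ipDr ipNr (wK _ Kk) subr0.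
by apply: le_trans (cauchy_schwarz _ _) _; rewrite ler_wpM2l// sqnorm_ge0.
Qed.

Lemma projects_to_uniq K v p q : subspace K ->
  projects_to K v p -> projects_to K v q -> p = q.
Proof.
move=> subK [Kp vp] [Kq vq]; apply/eqP; rewrite -subr_eq0; apply/eqP.
have Kpq : dot_closure K (p - q).
  by rewrite addrC -scaleN1r; apply (dot_closure_subspace subK).2.
apply: sqnorm_eq0; rewrite /sqnorm (@orthogonal_closure K)// => k Kk.
have -> : p - q = (v - q) - (v - p).
  by rewrite opprB addrCA addrAC subrr add0r addrC.
by rewrite ipDl ipNl vp// vq// subrr.
Qed.

(** The classical minimization: by the parallelogram law, points of [K] whose
    distances to [v] tend to the infimum form a Cauchy sequence, and its limit
    is the projection because near-minimizers are nearly orthogonal to [K]. *)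
Lemma projects_to_exists K v : dot_complete -> subspace K ->
  exists p, projects_to K v p.
Proof.
move=> cplt [K0 KD].
pose D := [set sqnorm (v - k) | k in K]; pose d := inf D.
have infD : has_inf D.
  split; first by exists (sqnorm (v - 0)), 0.
  by exists 0 => _ [k _ <-]; exact: sqnorm_ge0.
have dle k : K k -> d <= sqnorm (v - k).
  by move=> Kk; apply: ge_inf; [exact: infD.2|exists k].
have : forall n : nat, exists k, K k /\ sqnorm (v - k) < d + n.+1%:R^-1.
  move=> n; have n0 : 0 < n.+1%:R^-1 :> R by rewrite invr_gt0.
  by have [_ [k Kk <-] vk] := inf_adherent n0 infD; exists k.
move=> /choice[x Kx].
have small e : 0 < e ->
    exists N : nat, forall i, (N <= i)%N -> i.+1%:R^-1 <= e :> R.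
  move=> e0; exists (Num.bound e^-1) => i Ni.
  rewrite invf_ple ?posrE//; apply: ltW.
  apply: lt_le_trans (archi_boundP _) _; first by rewrite invr_ge0 ltW.
  by rewrite ler_nat ltnW.
have [l xl] : exists l, dot_cvg x l.
  apply: cplt => e e0; have /small[N NP] : 0 < e / 4 by lra.
  exists N => i j /NP iN /NP jN.
  have {iN} [Ki xi] : K (x i) /\ sqnorm (v - x i) <= d + e / 4.
    have [Kxi lti] := Kx i; split=> //.
    by apply/ltW/(lt_le_trans lti); rewrite lerD2l.
  have {jN} [Kj xj] : K (x j) /\ sqnorm (v - x j) <= d + e / 4.
    have [Kxj ltj] := Kx j; split=> //.
    by apply/ltW/(lt_le_trans ltj); rewrite lerD2l.
  (* The midpoint is in K, so its squared distance to v is at least d too. *)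
  set h := 2^-1 *: (x i + x j).
  have Kh : K h.
    rewrite /h -[_ *: _]addr0; apply: (KD) => //.
    by rewrite -[x i]scale1r; exact: KD.
  have := dle _ Kh.
  have -> : v - h = 2^-1 *: ((v - x i) + (v - x j)).
    rewrite addrACA -opprD scalerBr /h; congr (_ - _).
    rewrite -[v + v]mulr2n -[v *+ 2]scaler_nat scalerA.
    by rewrite mulVf ?scale1r// pnatr_eq0.
  have -> : (2^-1 : Cplx R) = toC 2^-1 * 1.
    rewrite mulr1 [RHS](fmorphV (real_complex R)); congr (_^-1).
    exact: esym (rmorph_nat (real_complex R) 2).
  rewrite sqnormZ sqmod_toCM.
  have -> : sqmod (1 : Cplx R) = 1 by rewrite /sqmod /re /=; ring.
  have -> : x i - x j = (v - x j) - (v - x i).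
    by rewrite opprB addrCA addrAC subrr add0r addrC.
  rewrite (sqnormD (v - x i)) (sqnormB (v - x j)) (ipC (v - x j)) re_conj.
  set a := sqnorm (v - x i) in xi *; set b := sqnorm (v - x j) in xj *.
  set c := re _; lra.
exists l; split=> [e e0|k Kk].
  have [N /(_ N (leqnn _)) lN] := xl e e0.
  by exists (x N); [exact: (Kx N).1|rewrite sqnormBC].
apply/sqmod_eq0/(@small_le0 _ _ (4 * sqnorm k)).
  by rewrite mulr_ge0// sqnorm_ge0.
move=> e e0; have [N NP] := small e e0; have [M MP] := xl e e0.
have /NP en := leq_maxl N M; have /MP xn := leq_maxr N M.
set n := maxn N M in en xn; have [Kn xvn] := Kx n.
have -> : ip (v - l) k = ip (v - x n) k + ip (x n - l) k.
  by rewrite -ipDl addrA subrK.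
apply: le_trans (sqmodD_le _ _) _.
have h1 : sqmod (ip (v - x n) k) <= (sqnorm (v - x n) - d) * sqnorm k.
  apply: near_orthogonal => c; rewrite -addrA -opprD; apply: dle.
  by rewrite addrC; exact: KD.
have h2 := cauchy_schwarz (x n - l) k.
have h3 : (sqnorm (v - x n) - d) * sqnorm k <= e * sqnorm k.
  by rewrite ler_wpM2r ?sqnorm_ge0// lerBlDl (le_trans (ltW xvn))// lerD2l.
have h4 : sqnorm (x n - l) * sqnorm k <= e * sqnorm k.
  by rewrite ler_wpM2r ?sqnorm_ge0.
lra.
Qed.

Section Projector.
Variables (K : set V) (P : V -> V).
Hypotheses (subK : subspace K) (projP : forall v, projects_to K v (P v)).

Lemma projector_id v : dot_closure K v -> P v = v.
Proof.
move=> Kv; apply: (projects_to_uniq subK (projP v)); split=> // k _.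
by rewrite subrr ip0l.
Qed.

Lemma projector_linear c u v : P (c *: u + v) = c *: P u + P v.
Proof.
apply: (projects_to_uniq subK (projP _)).
have [[Ku uK] [Kv vK]] := (projP u, projP v); split=> [|k Kk].
  exact: (dot_closure_subspace subK).2.
by rewrite opprD addrACA -scalerBr ipDl ipZl uK// vK// mulr0 addr0.
Qed.

Lemma projector_ipl u v : ip (P u) v = ip (P u) (P v).
Proof.
apply/eqP; rewrite -subr_eq0 -ipNr -ipDr ipC (@orthogonal_closure K) ?conjC0//.
  exact: (projP v).2.
exact: (projP u).1.
Qed.

Lemma projector_sym u v : ip (P u) v = ip u (P v).
Proof. by rewrite projector_ipl (ipC u) (projector_ipl v) -ipC. Qed.

Lemma projector_contract v : sqnorm (P v) <= sqnorm v.
Proof.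
have := sqnorm_ge0 (v - P v).
rewrite sqnormB ipC re_conj projector_ipl -/(sqnorm (P v)); lra.
Qed.

(** If [T] and its adjoint map [K] to itself, then [T] preserves both the
    closure of [K] and its orthogonal complement. *)
Lemma projector_commute (T T' : V -> V) (B : R) : 0 <= B ->
    (forall u v, T (u - v) = T u - T v) ->
    (forall v, sqnorm (T v) <= B * sqnorm v) ->
    (forall u v, ip (T u) v = ip u (T' v)) ->
    (forall k, K k -> K (T k)) -> (forall k, K k -> K (T' k)) ->
  forall v, P (T v) = T (P v).
Proof.
move=> B0 TB boundT adjT KT KT' v; apply: (projects_to_uniq subK (projP _)).
have [Kv vK] := projP v; split=> [e e0|k Kk]; last first.
  by rewrite -TB adjT vK//; exact: KT'.
have B1 : 0 < B + 1 by lra.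
have [k Kk vk] := Kv _ (divr_gt0 e0 B1); exists (T k); first exact: KT.
rewrite -TB; apply: le_trans (boundT _) _.
move: vk; rewrite ler_pdivlMr//; have := sqnorm_ge0 (P v - k); nra.
Qed.

End Projector.

End DotProduct.

(** * Bounded operators and norm completeness *)

Section Hilbert.
Context {R : realType} {H : hilbertSpace R}.
Local Notation ip := (@inner R H).
Local Notation sqnormH := (sqnorm (@inner R H)).
Implicit Types (u v : H) (T : H -> H).

Lemma norm_toC u : `|u| = toC (re `|u|).
Proof. by rewrite reK// normr_real. Qed.

Lemma sqnormHE u : sqnormH u = re `|u| ^+ 2.
Proof.
rewrite /sqnorm -(inner_norm u) norm_toC expr2 re_toCM toCK; ring.
Qed.

Lemma norm_le_sqnorm u (r : R) : 0 <= r ->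
  (`|u| <= toC r) = (sqnormH u <= r ^+ 2).
Proof.
by move=> r0; rewrite norm_toC toC_le sqnormHE ler_sqr// nnegrE re_ge0.
Qed.

Lemma hilbert_complete : dot_complete ip.
Proof.
move=> x cx.
have e2 (e : R) : 0 < e -> 0 < (e / 2) ^+ 2.
  by move=> e0; rewrite exprn_gt0// divr_gt0.
have cvx : cvgn x.
  apply/(@cauchy_cvgP H)/cauchy_exP => e e0.
  have [N NP] := cx _ (e2 _ (re_gt0 e0)).
  exists (x N), N => // j /= jN; rewrite -ball_normE /=.
  have := NP _ _ (leqnn N) jN; have re0 := re_gt0 e0.
  have re2 : 0 <= re e / 2 by lra.
  rewrite -norm_le_sqnorm// => /le_lt_trans.
  apply; rewrite -[ltRHS](reK (gtr0_real e0)) toC_lt; lra.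
exists (limn x) => e e0.
have se0 : 0 < Num.sqrt e by rewrite sqrtr_gt0.
move/(@cvgrPdist_le _ H): (cvx) => /(_ (toC (Num.sqrt e))).
rewrite toC_gt0 se0 => /(_ isT) [N _ NP]; exists N => i /NP /=.
by rewrite (norm_le_sqnorm _ (ltW se0)) sqnormBC sqr_sqrtr// ltW.
Qed.

Lemma bounded_op_sqnorm T : bounded_op T ->
  exists2 B : R, 0 <= B & forall u, sqnormH (T u) <= B * sqnormH u.
Proof.
move=> [linT contT].
pose f : {linear H -> H} := HB.pack T (GRing.isLinear.Build _ _ _ _ T linT).
have /linear_boundedP/pinfty_ex_gt0 [M M0 MP] : bounded_near f (nbhs 0).
  by apply: continuous_linear_bounded; exact: contT.
exists (re M ^+ 2) => [|u]; first exact: sqr_ge0.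
have rM := re_gt0 M0.
rewrite (sqnormHE u) -exprMn -norm_le_sqnorm; last first.
  by rewrite mulr_ge0 ?re_ge0// ltW.
by rewrite toCM (reK (gtr0_real M0)) -norm_toC; exact: MP.
Qed.

Lemma sqnorm_bounded_op T (B : R) : 0 <= B -> linear T ->
  (forall u, sqnormH (T u) <= B * sqnormH u) -> bounded_op T.
Proof.
move=> B0 linT TB; split=> //.
pose f : {linear H -> H} := HB.pack T (GRing.isLinear.Build _ _ _ _ T linT).
suff : bounded_near f (nbhs 0) by move=> /bounded_linear_continuous.
apply/linear_boundedP; exists (toC (Num.sqrt B)); split=> [|r Br u].
  by rewrite ger0_real// toC_ge0 sqrtr_ge0.
have h : `|T u| <= toC (Num.sqrt B) * `|u|.
  rewrite (norm_toC u) -toCM norm_le_sqnorm ?mulr_ge0// ?sqrtr_ge0// ?re_ge0//.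
  by rewrite exprMn sqr_sqrtr// -sqnormHE.
by apply: le_trans h _; rewrite ler_wpM2r// ltW.
Qed.

End Hilbert.

(** * The Hilbert space of square-summable sequences *)

Section SquareSummable.
Context {R : realType} {H : hilbertSpace R}.
Local Notation ip := (@inner R H).
Local Notation sqnormH := (sqnorm (@inner R H)).
Implicit Types (xi : nat -> H).

(** Square-summability through bounded partial sums: stability under sums and
    under bounded operators then involves no limit. *)
Definition sum_bounded xi : Prop :=
  exists B : R, forall N, \sum_(0 <= n < N) sqnormH (xi n) <= B.

Definition l2_pred : {pred nat -> H} := [pred xi | `[< sum_bounded xi >]].

Lemma l2_submod_closed : submod_closed l2_pred.
Proof.
split=> [|c u v /asboolP[A uA] /asboolP[B vB]]; apply/asboolP.
  exists 0 => N; rewrite big1// => i _.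
  by rewrite /sqnorm ip0l.
exists (2 * sqmod c * A + 2 * B) => N.
apply: le_trans (_ : \sum_(0 <= n < N)
  (2 * sqmod c * sqnormH (u n) + 2 * sqnormH (v n)) <= _).
  apply: ler_sum => i _.
  by rewrite (le_trans (sqnormD_le _ _ _))// sqnormZ mulrA.
rewrite big_split /= -!mulr_sumr lerD// ler_wpM2l// mulr_ge0//.
exact: sqmod_ge0.
Qed.

HB.instance Definition _ :=
  GRing.isSubmodClosed.Build (Cplx R) (nat -> H) l2_pred l2_submod_closed.

Record l2 := L2 {l2val :> nat -> H; l2valP : l2val \in l2_pred}.
HB.instance Definition _ := [isSub for l2val].
HB.instance Definition _ := [Choice of l2 by <:].
HB.instance Definition _ := [SubChoice_isSubLmodule of l2 by <:].

Lemma l2_bounded (u : l2) : sum_bounded u.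
Proof. by have /asboolP := l2valP u. Qed.

Lemma l2DE (u v : l2) n : (u + v) n = u n + v n. Proof. by []. Qed.
Lemma l2BE (u v : l2) n : (u - v) n = u n - v n. Proof. by []. Qed.
Lemma l2ZE c (u : l2) n : (c *: u) n = c *: u n. Proof. by []. Qed.

Lemma l2_ext (u v : l2) : (forall n, u n = v n) -> u = v.
Proof. by move=> uv; apply: val_inj; apply/funext. Qed.

Lemma cvg_series_sqnorm (u : l2) : cvgn (series (fun n => sqnormH (u n))).
Proof.
have [B uB] := l2_bounded u.
apply: nondecreasing_is_cvgn.
  by apply/nondecreasing_series => n _ _; exact: sqnorm_ge0.
by exists B => _ [N _ <-]; exact: uB.
Qed.

Lemma cvg_series_ipvv (u : l2) :
  series (fun n => ip (u n) (u n)) @ \oo -->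
    toC (limn (series (fun n => sqnormH (u n)))).
Proof.
have -> : series (fun n => ip (u n) (u n)) =
    toC \o series (fun n => sqnormH (u n)).
  apply/funext => N; rewrite /series /= toC_sum.
  by apply: eq_bigr => i _; exact: ipvv.
exact/cvg_toC/cvg_series_sqnorm.
Qed.

(** This reduces the convergence of the series defining the inner product of
    two sequences to the case of bounded nondecreasing real sums. *)
Lemma polarization (u v : H) : ip u v =
  2^-1 * ((ip (u + v) (u + v) - ip u u - ip v v) +
   'i * (ip (u + 'i *: v) (u + 'i *: v) - ip u u - ip v v)).
Proof.
rewrite !ipDl !ipDr !ipZl !ipZr conjCi.
have i2 : 'i * 'i = -1 :> Cplx R by rewrite -expr2 sqrCi.
set a := ip u u; set b := ip v v; set c := ip u v; set d := ip v u.
set i : Cplx R := 'i in i2 *.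
transitivity (2^-1 * (c + d - i * i * c + i * i * d - i * (i * i + 1) * b)).
  by rewrite i2; field.
by field.
Qed.

Lemma cvg_series_ip (u v : l2) : cvgn (series (fun n => ip (u n) (v n))).
Proof.
have cvg1 (w : l2) : cvgn (series (fun n => ip (w n) (w n))).
  exact: cvgP (@cvg_series_ipvv w).
pose S (w : l2) n := ip (w n) (w n).
have -> : (fun n => ip (u n) (v n)) = (2^-1 : Cplx R) *:
    ((S (u + v) - S u - S v) +
     ('i : Cplx R) *: (S (u + 'i *: v) - S u - S v)).
  by apply/funext => n; rewrite polarization.
apply: (@is_cvg_seriesZ (Cplx R)).
apply: (@is_cvg_seriesD (Cplx R)).
  by do 2 (apply: is_cvg_seriesB; last exact: cvg1); exact: cvg1.
apply: (@is_cvg_seriesZ (Cplx R)).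
by do 2 (apply: is_cvg_seriesB; last exact: cvg1); exact: cvg1.
Qed.

Definition l2dot (u v : l2) : Cplx R := limn (series (fun n => ip (u n) (v n))).

Lemma l2dot_cvg (u v : l2) :
  series (fun n => ip (u n) (v n)) @ \oo --> l2dot u v.
Proof. exact: cvg_series_ip. Qed.

Lemma l2dot_uniq (u v : l2) z :
  series (fun n => ip (u n) (v n)) @ \oo --> z -> l2dot u v = z.
Proof. exact: (@cvg_lim (Cplx R)). Qed.

Lemma l2dotl w : linear_for *%R (l2dot^~ w).
Proof.
move=> c u v; apply: l2dot_uniq.
have -> : series (fun n => ip ((c *: u + v) n) (w n)) =
  (fun n => c * series (fun n => ip (u n) (w n)) n +
    series (fun n => ip (v n) (w n)) n).
  apply/funext => N; rewrite /series /= mulr_sumr -big_split.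
  by apply: eq_bigr => i _ /=; rewrite -ipZl -ipDl.
apply: (@cvgD (Cplx R)); last exact: l2dot_cvg.
by apply: (@cvgMl_tmp (Cplx R)); exact: l2dot_cvg.
Qed.

Lemma l2dotC u v : l2dot u v = (l2dot v u)^*.
Proof.
apply: l2dot_uniq.
have -> : series (fun n => ip (u n) (v n)) =
    Num.conj \o series (fun n => ip (v n) (u n)).
  apply/funext => N; rewrite /series /= rmorph_sum.
  by apply: eq_bigr => i _ /=; rewrite -ipC.
apply/(@cvgrPdist_lt (Cplx R)) => e e0.
move/(@cvgrPdist_lt (Cplx R)): (@l2dot_cvg v u) => /(_ _ e0).
apply: filterS => n.
by rewrite /= -rmorphB norm_conjC.
Qed.

Lemma l2dotr w : linear_for (Num.conj \; *%R) (l2dot w).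
Proof.
move=> c u v; rewrite l2dotC l2dotl rmorphD rmorphM /=.
by rewrite (l2dotC w u) (l2dotC w v).
Qed.

Lemma l2dotvv u : l2dot u u = toC (limn (series (fun n => sqnormH (u n)))).
Proof. exact/l2dot_uniq/cvg_series_ipvv. Qed.

Lemma l2dot_pos u : u != 0 -> 0 < l2dot u u.
Proof.
move=> u0; have [n un] : exists n, u n != 0.
  apply: contrapT => h; case/eqP: u0; apply: l2_ext => n.
  by apply/eqP/negPn/negP => un; apply: h; exists n.
rewrite l2dotvv toC_gt0; have un0 : 0 < sqnormH (u n).
  by rewrite re_gt0// neq0_dnorm_gt0.
apply: lt_le_trans un0 _.
apply: le_trans (nondecreasing_cvgn_le _ (@cvg_series_sqnorm u) n.+1).
  rewrite /series /= big_nat_recr//= lerDr sumr_ge0// => i _; exact: sqnorm_ge0.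
by apply/nondecreasing_series => k _ _; exact: sqnorm_ge0.
Qed.

HB.instance Definition _ :=
  bilinear_isBilinear.Build (Cplx R) l2 l2 (Cplx R) *%R (Num.conj \; *%R)
    l2dot (l2dotl, l2dotr).
HB.instance Definition _ :=
  isHermitianSesquilinear.Build (Cplx R) l2 false Num.conj l2dot
    (fun u v => etrans (l2dotC u v) (esym (mul1r _))).
HB.instance Definition _ := isDotProduct.Build (Cplx R) l2 l2dot l2dot_pos.
Definition l2ip : {dot l2 for Num.conj} := l2dot.

End SquareSummable.

Section L2Theory.
Context {R : realType} {H : hilbertSpace R}.
Local Notation ip := (@inner R H).
Local Notation sqnormH := (sqnorm (@inner R H)).
Local Notation l2 := (@l2 R H).
Local Notation l2ip := (@l2ip R H).
Implicit Types (u v w : l2) (a b : H) (T : H -> H).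

Lemma l2_sqnormE u : sqnorm l2ip u = limn (series (fun n => sqnormH (u n))).
Proof. by rewrite /sqnorm [l2ip u u]l2dotvv. Qed.

Lemma l2_partial u N : \sum_(0 <= n < N) sqnormH (u n) <= sqnorm l2ip u.
Proof.
rewrite l2_sqnormE.
apply: (nondecreasing_cvgn_le _ (@cvg_series_sqnorm _ _ u) N).
by apply/nondecreasing_series => k _ _; exact: sqnorm_ge0.
Qed.

Lemma l2_sqnorm_le u (B : R) :
  (forall N, \sum_(0 <= n < N) sqnormH (u n) <= B) -> sqnorm l2ip u <= B.
Proof.
move=> uB; rewrite l2_sqnormE; apply: limr_le; first exact: cvg_series_sqnorm.
by apply: nearW => N; exact: uB.
Qed.

Lemma l2_coord u n : sqnormH (u n) <= sqnorm l2ip u.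
Proof.
apply: le_trans (l2_partial u n.+1); rewrite big_nat_recr//= lerDr.
by rewrite sumr_ge0// => i _; exact: sqnorm_ge0.
Qed.

Lemma single_subproof j a : (fun n => if n == j then a else 0) \in @l2_pred R H.
Proof.
apply/asboolP; exists (sqnormH a) => N.
have z0 : sqnormH 0 = 0 by rewrite /sqnorm ip0l.
have -> : \sum_(0 <= n < N) sqnormH (if n == j then a else 0) =
    \sum_(0 <= n < N | n == j) sqnormH a.
  by rewrite [RHS]big_mkcond; apply: eq_bigr => n _; case: eqP.
rewrite big_nat1_eq; case: ifP => // _; exact: sqnorm_ge0.
Qed.

Definition single j a : l2 := L2 (single_subproof j a).

Lemma singleE j a n : single j a n = if n == j then a else 0.
Proof. by []. Qed.

Lemma l2ip_single u j a : l2ip u (single j a) = ip (u j) a.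
Proof.
apply: l2dot_uniq; apply: (@cvg_near_cst _ (Cplx R)); exists j.+1 => // N /= jN.
rewrite /series /=; apply/eqP.
have -> : \sum_(0 <= n < N) ip (u n) (single j a n) =
    \sum_(0 <= n < N | n == j) ip (u j) a.
  rewrite [RHS]big_mkcond; apply: eq_bigr => n _; rewrite singleE.
  by case: eqP => [->//|_]; exact: ip0r.
by rewrite big_nat1_eq jN.
Qed.

Lemma sqnorm_single j a : sqnorm l2ip (single j a) = sqnormH a.
Proof. by rewrite /sqnorm l2ip_single singleE eqxx. Qed.

Lemma single_linear j (c : Cplx R) a b :
  single j (c *: a + b) = c *: single j a + single j b.
Proof.
apply: l2_ext => n; rewrite l2DE l2ZE !singleE; case: eqP => // _.
by rewrite scaler0 addr0.
Qed.

(** The limit [l] is taken coordinatewise. Partial sums of the squared norms of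
    [x i - l] are compared with those of [x j - l] for some [j] that depends on
    the length of the sum, while the resulting bound does not. *)
Lemma l2_complete : dot_complete l2ip.
Proof.
move=> x cx.
have cn n : dot_cauchy ip (fun i => x i n).
  move=> e /cx[N NP]; exists N => i j iN jN.
  apply: le_trans (NP i j iN jN); rewrite -l2BE; exact: l2_coord.
have /choice[l xl] n := hilbert_complete (cn n).
have tail N (e : R) : 0 < e -> exists J : nat, forall i, (J <= i)%N ->
    \sum_(0 <= n < N) sqnormH (x i n - l n) <= e.
  elim: N e => [|N IH] e e0; first by exists 0%N => i _; rewrite big_nil ltW.
  have e2 : 0 < e / 2 by lra.
  have [J JP] := IH _ e2; have [J' JP'] := xl N _ e2.
  exists (maxn J J') => i; rewrite geq_max => /andP[/JP iJ /JP' iJ'].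
  by rewrite big_nat_recr//=; lra.
have sumBC (i j : nat) N : (\sum_(0 <= n < N) sqnormH (x i n - l n) <=
     2 * sqnorm l2ip (x i - x j) + 2 * \sum_(0 <= n < N) sqnormH (x j n - l n)).
  have := l2_partial (x i - x j) N; rewrite -(ler_pM2l (ltr0n R 2)).
  rewrite -(lerD2r (2 * \sum_(0 <= n < N) sqnormH (x j n - l n))).
  apply: le_trans; rewrite !mulr_sumr -big_split; apply: ler_sum => n _.
  by apply: le_trans (sqnormD_le _ _ _); rewrite l2BE addrA subrK.
have close (e : R) : 0 < e -> exists N : nat, forall i, (N <= i)%N ->
    forall k, \sum_(0 <= n < k) sqnormH (x i n - l n) <= e.
  move=> e0; have e4 : 0 < e / 4 by lra.
  have [N NP] := cx _ e4; exists N => i iN k.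
  have [J JP] := tail k _ e4.
  have := sumBC i (maxn N J) k; have := NP i (maxn N J) iN (leq_maxl _ _).
  have := JP _ (leq_maxr N J); lra.
have l2l : l \in @l2_pred R H.
  have [N NP] := close 1 ltr01; apply/asboolP.
  exists (2 * sqnorm l2ip (x N) + 2) => k.
  apply: le_trans (_ : 2 * \sum_(0 <= n < k) sqnormH (x N n) + 2 *
     \sum_(0 <= n < k) sqnormH (x N n - l n) <= _).
    rewrite !mulr_sumr -big_split; apply: ler_sum => n _.
    have := sqnormD_le ip (x N n) (- (x N n - l n)).
    by rewrite sqnormN opprB addrC subrK.
  have := NP N (leqnn N) k; have := l2_partial (x N) k; lra.
exists (L2 l2l) => e /close[N NP]; exists N => i iN.
by apply: l2_sqnorm_le => k; exact: NP.
Qed.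

Lemma amp_subproof T (bT : bounded_op T) u :
  (fun n => T (u n)) \in @l2_pred R H.
Proof.
have [B B0 TB] := bounded_op_sqnorm bT; apply/asboolP.
exists (B * sqnorm l2ip u) => N.
apply: le_trans (ler_wpM2l B0 (l2_partial u N)).
by rewrite mulr_sumr; apply: ler_sum => n _; exact: TB.
Qed.

(** The diagonal operator of [T] on sequences, i.e. the tensor product of the
    identity with [T]. *)
Definition amp T (bT : bounded_op T) u : l2 := L2 (amp_subproof bT u).

Lemma ampE T (bT : bounded_op T) u n : amp bT u n = T (u n).
Proof. by []. Qed.

Lemma amp_bounded T (bT : bounded_op T) : exists2 B : R, 0 <= B &
  forall u, sqnorm l2ip (amp bT u) <= B * sqnorm l2ip u.
Proof.
have [B B0 TB] := bounded_op_sqnorm bT; exists B => // u.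
apply: l2_sqnorm_le => N; apply: le_trans (ler_wpM2l B0 (l2_partial u N)).
by rewrite mulr_sumr; apply: ler_sum => n _; exact: TB.
Qed.

Lemma amp_adjoint T T' (bT : bounded_op T) (bT' : bounded_op T') :
  adjoint_op T T' -> forall u v, l2ip (amp bT u) v = l2ip u (amp bT' v).
Proof.
move=> TT' u v; apply: l2dot_uniq; have := @l2dot_cvg _ _ u (amp bT' v).
by under eq_fun do rewrite ampE -TT'.
Qed.

Lemma bounded_opB T a b : bounded_op T -> T (a - b) = T a - T b.
Proof.
move=> [linT _]; rewrite addrC -scaleN1r linT scaleN1r addrC //.
Qed.

Lemma bounded_op0 T : bounded_op T -> T 0 = 0.
Proof. by move=> bT; rewrite -[X in T X](subrr 0) bounded_opB// subrr. Qed.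

Lemma amp_single T (bT : bounded_op T) j a :
  amp bT (single j a) = single j (T a).
Proof.
apply: l2_ext => n; rewrite ampE !singleE; case: eqP => // _.
by rewrite bounded_op0.
Qed.

End L2Theory.

(** * Density of a star-subalgebra in its bicommutant *)

Section Density.
Context {R : realType} {H : hilbertSpace R}.
Local Notation ip := (@inner R H).
Local Notation sqnormH := (sqnorm (@inner R H)).
Local Notation l2 := (@l2 R H).
Local Notation l2ip := (@l2ip R H).
Implicit Types (u v w : l2) (a b : H) (M : set (H -> H)).

Lemma adjoint_opC (x y : H -> H) : adjoint_op x y -> adjoint_op y x.
Proof. by move=> xy u v; rewrite ipC -xy -ipC. Qed.

(** Von Neumann's density theorem in the ultrastrong topology. The projection
    [P] on the closure of the orbit of [zeta] under [M] commutes with the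
    amplification of [M], so its matrix blocks lie in the commutant of [M] and
    commute with [x]; hence [P] fixes the image of [zeta] under the
    amplification of [x], which therefore lies in the closure of the orbit.
    Sequences rather than single vectors are required because a normal
    functional is an infinite sum of vector functionals, which cannot be
    truncated: the approximants [m] come without a bound on their norms. *)
Lemma bicommutant_density M (x y : H -> H) (zeta : l2) (e : R) :
    star_subalgebra M -> bounded_op x -> bounded_op y -> adjoint_op x y ->
    commutant (commutant M) x -> 0 < e ->
  exists2 m, M m &
    forall N, \sum_(0 <= n < N) sqnormH (x (zeta n) - m (zeta n)) <= e.
Proof.
move=> starM bx by_ xy [_ xM] e0.
pose K : set l2 := [set k | exists2 m, M m & forall n, k n = m (zeta n)].
have subK : subspace K.
  split=> [|c k k' [m Mm km] [m' Mm' km']].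
    exists ((- 1) *: idfun + idfun).
      by apply: (star_linear starM); exact: (star_id starM).
    by move=> n; rewrite /= scaleN1r addNr.
  exists (c *: m + m'); first exact: (star_linear starM).
  by move=> n; rewrite l2DE l2ZE km km'.
have Kzeta : K zeta by exists idfun => //; exact: (star_id starM).
have /choice[P projP] v := projects_to_exists v (@l2_complete R H) subK.
have Pzeta : P zeta = zeta.
  apply: (projector_id subK projP) => d d0; exists zeta => //.
  by rewrite subrr /sqnorm ip0l ltW.
have ampP m (bm : bounded_op m) v : M m -> P (amp bm v) = amp bm (P v).
  move=> Mm; have [B B0 mB] := amp_bounded bm.
  have [m' Mm' mm'] := star_adjoint starM Mm.
  have bm' := star_bounded starM Mm'.
  apply: (projector_commute subK projP B0 _ mB (amp_adjoint bm bm' mm')).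
  - by move=> u w; apply: l2_ext => n; rewrite ampE !l2BE bounded_opB.
  - move=> k [p Mp kp]; exists (m \o p); first exact: (star_comp starM).
    by move=> n; rewrite ampE kp.
  - move=> k [p Mp kp]; exists (m' \o p); first exact: (star_comp starM).
    by move=> n; rewrite ampE kp.
(* The (i, j) matrix block of P. *)
pose block i j : H -> H := fun a => P (single j a) i.
have blockM i j : commutant M (block i j).
  split.
    apply: (@sqnorm_bounded_op _ _ _ 1) => // [c a b|a].
      by rewrite /block single_linear (projector_linear subK projP) l2DE l2ZE.
    rewrite mul1r -(sqnorm_single j a); apply: le_trans (l2_coord _ _) _.
    exact: (projector_contract projP).
  move=> m Mm; apply/funext => a /=.
  by rewrite /block -(amp_single (star_bounded starM Mm)) ampP.
have xblock i j a : x (block i j a) = block i j (x a).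
  by have /(congr1 (fun f => f a)) := xM _ (blockM i j).
have block_adj i j a b : ip (block i j a) b = ip a (block j i b).
  rewrite -l2ip_single (projector_sym projP) ipC.
  by rewrite l2ip_single -ipC.
have yx := adjoint_opC xy.
(* The block adjoints are blocks again, as P is self-adjoint; so y commutes
   with the blocks because x does. *)
have yblock i j a : y (block i j a) = block i j (y a).
  apply: (@ip_ext _ _ ip) => w.
  by rewrite yx block_adj -xblock -yx -block_adj.
have : dot_closure l2ip K (amp bx zeta).
  suff <- : P (amp bx zeta) = amp bx zeta by have [] := projP (amp bx zeta).
  apply: l2_ext => i; apply: (@ip_ext _ _ ip) => w.
  rewrite -l2ip_single (projector_sym projP) (amp_adjoint _ by_ xy).
  have -> : amp by_ (P (single i w)) = P (single i (y w)).
    by apply: l2_ext => n; rewrite ampE; exact: yblock.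
  by rewrite -(projector_sym projP) Pzeta l2ip_single ampE xy.
move=> /(_ _ e0)[k [m Mm km] xk]; exists m => // N.
apply: le_trans xk; apply: le_trans (l2_partial _ N).
by apply: ler_sum => n _; rewrite l2BE km.
Qed.
End Density.

(** * Fixed points of state-preserving automorphisms *)

Section FixedPoints.
Context {R : realType} {H : hilbertSpace R}.
Local Notation ip := (@inner R H).
Local Notation sqnormH := (sqnorm (@inner R H)).
Implicit Types (x y a b : H -> H) (A M : set (H -> H)).
Implicit Types (phi : (H -> H) -> Cplx R).

Lemma bounded_opD x (u v : H) : bounded_op x -> x (u + v) = x u + x v.
Proof. by move=> [linx _]; rewrite -[u]scale1r linx !scale1r. Qed.

Lemma adjoint_op_uniq x y y' : adjoint_op x y -> adjoint_op x y' -> y = y'.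
Proof.
move=> xy xy'; apply/funext => u; apply: (@ip_ext _ _ ip) => w.
by rewrite (adjoint_opC xy) (adjoint_opC xy').
Qed.

Lemma positive_op_sq x y : adjoint_op x y -> positive_op (y \o x).
Proof. by move=> xy u; rewrite /= (adjoint_opC xy) ip_ge0. Qed.

Lemma adjoint_comp_eq0 x y : adjoint_op x y -> y \o x = 0 -> x = 0.
Proof.
move=> xy yx0; apply/funext => u; apply: (@sqnorm_eq0 _ _ ip).
have -> : sqnormH (x u) = re (ip ((y \o x) u) u) by rewrite /= (adjoint_opC xy).
by rewrite yx0 ip0l.
Qed.

Lemma adjoint_opB x x' y y' :
  adjoint_op x x' -> adjoint_op y y' -> adjoint_op (x - y) (x' - y').
Proof.
move=> xx' yy' u v.
by rewrite -![(_ - _) _]/(_ _ - _ _) ipDl ipNl ipDr ipNr xx' yy'.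
Qed.

Lemma adjoint_opD x x' y y' :
  adjoint_op x x' -> adjoint_op y y' -> adjoint_op (x + y) (x' + y').
Proof.
by move=> xx' yy' u v; rewrite -![(_ + _) _]/(_ _ + _ _) ipDl ipDr xx' yy'.
Qed.

Section StarSubalgebra.
Variables (M : set (H -> H)) (starM : star_subalgebra M).

Lemma star_add x y : M x -> M y -> M (x + y).
Proof. by move=> Mx My; rewrite -[x]scale1r; exact: star_linear. Qed.

Lemma star_zero : M 0.
Proof.
have Mid := star_id starM.
by have := star_linear starM (- 1) Mid Mid; rewrite scaleN1r addNr.
Qed.

Lemma star_sub x y : M x -> M y -> M (x - y).
Proof. by move=> Mx My; rewrite addrC -scaleN1r; exact: star_linear. Qed.

Lemma star_scalar (c : Cplx R) : M (c *: idfun).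
Proof.
rewrite -[_ *: _]addr0; apply: star_linear => //.
  exact: star_id.
exact: star_zero.
Qed.

Lemma linear_onD (V : lmodType (Cplx R)) (f : (H -> H) -> V) x y :
  linear_on M f -> M x -> M y -> f (x + y) = f x + f y.
Proof. by move=> linf Mx My; rewrite -[x]scale1r linf// !scale1r. Qed.

Lemma linear_onB (V : lmodType (Cplx R)) (f : (H -> H) -> V) x y :
  linear_on M f -> M x -> M y -> f (x - y) = f x - f y.
Proof.
move=> linf Mx My.
by rewrite [x - y]addrC -[- y]scaleN1r linf// scaleN1r addrC.
Qed.

End StarSubalgebra.

Lemma comp_parallelogram a a' b b' : bounded_op a' -> bounded_op b' ->
  ((a' - b') \o (a - b)) + ((a' + b') \o (a + b)) =
  ((a' \o a) + (a' \o a)) + ((b' \o b) + (b' \o b)).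
Proof.
move=> ba' bb'; apply/funext => u.
transitivity ((a' (a u - b u) - b' (a u - b u)) +
  (a' (a u + b u) + b' (a u + b u))) => //.
rewrite (bounded_opB _ _ ba') (bounded_opB _ _ bb').
rewrite (bounded_opD _ _ ba') (bounded_opD _ _ bb').
set p := a' (a u); set q := a' (b u); set r := b' (a u); set s := b' (b u).
transitivity ((p + p) + (s + s)) => //.
rewrite opprB addrACA; congr (_ + _).
  by rewrite (addrC p q) addrA subrK.
by rewrite addrA subrK.
Qed.

(** The difference of the two sides is [phi ((a + b)* (a + b))]. *)
Lemma state_subM A phi a a' b b' :
    star_subalgebra A -> faithful_normal_state A phi ->
    A a -> A a' -> A b -> A b' -> adjoint_op a a' -> adjoint_op b b' ->
  re (phi ((a' - b') \o (a - b))) <=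
    2 * re (phi (a' \o a)) + 2 * re (phi (b' \o b)).
Proof.
move=> starA phiA Aa Aa' Ab Ab' aa' bb'.
have phiD x y : A x -> A y -> phi (x + y) = phi x + phi y.
  exact: (linear_onD (state_linear phiA)).
have AC x y : A x -> A y -> A (x \o y) by exact: star_comp.
have AD x y : A x -> A y -> A (x + y) by exact: star_add.
have AB x y : A x -> A y -> A (x - y) by exact: star_sub.
have := congr1 (re \o phi)
  (comp_parallelogram a b (star_bounded starA Aa') (star_bounded starA Ab')).
have Aaa : A (a' \o a) by exact: AC.
have Abb : A (b' \o b) by exact: AC.
have Am : A ((a' - b') \o (a - b)) by apply: (AC); exact: AB.
have Ap : A ((a' + b') \o (a + b)) by apply: (AC); exact: AD.
have phip : 0 <= re (phi ((a' + b') \o (a + b))).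
  by apply/re_ge0/(state_positive phiA) => //; exact/positive_op_sq/adjoint_opD.
rewrite /= (phiD _ _ Am Ap) (phiD _ _ (AD _ _ Aaa Aaa) (AD _ _ Abb Abb)).
rewrite (phiD _ _ Aaa Aaa) (phiD _ _ Abb Abb) !reD; lra.
Qed.

Lemma square_summable_l2 (xi : nat -> H) :
  square_summable xi -> xi \in @l2_pred R H.
Proof.
move=> xi2; apply/asboolP.
have xi_re N : \sum_(0 <= n < N) sqnormH (xi n) =
    re (series (fun n => `|xi n| ^+ 2) N).
  by rewrite re_sum; apply: eq_bigr => n _; rewrite inner_norm.
have cvgr := cvg_re xi2.
exists (re (limn (series (fun n => `|xi n| ^+ 2)))) => N.
rewrite xi_re -(cvg_lim _ cvgr)//.
apply: (nondecreasing_cvgn_le _ (cvgP _ cvgr) N).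
apply/nondecreasing_seqP => n; rewrite /= -!xi_re big_nat_recr//= lerDl.
exact: sqnorm_ge0.
Qed.

(** If [phi z] is the sum of [<z xi_n, eta_n>], then [phi (y \o x)] is the sum
    of [<x xi_n, x eta_n>], whose real part is at most a quarter of the squared
    norm of [x (xi_n + eta_n)]; thus [zeta = xi + eta] works for all [x] at
    once. *)
Lemma normal_functional_bound A phi :
    star_subalgebra A -> normal_functional A phi ->
  exists zeta : @l2 R H, forall x y (e : R), A x -> A y -> adjoint_op x y ->
    (forall N, \sum_(0 <= n < N) sqnormH (x (zeta n)) <= e) ->
    re (phi (y \o x)) <= e.
Proof.
move=> starA [xi [eta [xi2 eta2 cvphi]]].
exists (L2 (square_summable_l2 xi2) + L2 (square_summable_l2 eta2)).
move=> x y e Ax Ay xy xe.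
have cvgr := cvg_re (cvphi _ (star_comp starA Ay Ax)).
rewrite -(cvg_lim _ cvgr)//; apply: limr_le; first exact: cvgP cvgr.
apply: nearW => N; apply: le_trans (xe N).
rewrite -[leLHS]/(re (\sum_(0 <= n < N) ip (y (x (xi n))) (eta n))) re_sum.
apply: ler_sum => n _; rewrite (adjoint_opC xy).
rewrite l2DE (bounded_opD _ _ (star_bounded starA Ax)) /=.
have := sqnorm_ge0 ip (x (xi n) - x (eta n)).
have := sqnorm_ge0 ip (x (xi n) + x (eta n)).
rewrite sqnormB sqnormD; lra.
Qed.

Section Automorphism.
Variables (A : set (H -> H)) (phi : (H -> H) -> Cplx R).
Variable alpha : (H -> H) -> (H -> H).
Hypotheses (starA : star_subalgebra A) (autA : automorphism A phi alpha).

Lemma aut_in x : A x -> A (alpha x).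
Proof. by have [+ _ _] := aut_bij autA; apply. Qed.

(** If [alpha x] is the identity, then
    [alpha idfun = alpha idfun \o alpha x = alpha (idfun \o x)]. *)
Lemma aut_id : alpha idfun = idfun.
Proof.
have [_ _ surj] := aut_bij autA.
have [x Ax xid] := surj _ (star_id starA).
have Aid := star_id starA.
by have := aut_comp autA Aid Ax; rewrite -[idfun \o x]/x xid => {2}->.
Qed.

Lemma fixed_points_star : star_subalgebra (fixed_points A alpha).
Proof.
split.
- by move=> x [Ax _]; exact: star_bounded Ax.
- by split; [exact: star_id|exact: aut_id].
- move=> c x y [Ax fx] [Ay fy]; split; first exact: star_linear.
  by rewrite (aut_linear autA)// fx fy.
- move=> x y [Ax fx] [Ay fy]; split; first exact: star_comp.
  by rewrite (aut_comp autA)// fx fy.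
- move=> x [Ax fx]; have [y Ay xy] := star_adjoint starA Ax.
  exists y => //; split=> //; apply: (@adjoint_op_uniq x) => //.
  by rewrite -{1}fx; exact: (aut_adjoint autA).
Qed.

End Automorphism.

Lemma commutantS (S S' : set (H -> H)) :
  S `<=` S' -> commutant S' `<=` commutant S.
Proof. by move=> SS' x [bx xS]; split=> // s /SS'; exact: xS. Qed.

(** Invariance of the state replaces the continuity of [alpha]. For [x] in the
    bicommutant choose a fixed point [m] such that [w = x - m] makes
    [phi (w* w)] small. Since [alpha] fixes [m], [alpha x - x = alpha w - w],
    and the state of its absolute square is at most [4 phi (w* w)] because
    [alpha] preserves [phi]. Faithfulness of [phi] then gives [alpha x = x]. *)
Lemma fixed_points_vN A phi alpha : probability_space A phi ->
  automorphism A phi alpha -> von_neumann_algebra (fixed_points A alpha).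
Proof.
move=> [[starA AE] _ phiA] autA.
have starM := fixed_points_star starA autA; split=> //.
apply/seteqP; split=> [x Mx|x Mx]; last first.
  by split; [exact: star_bounded Mx|move=> s [_ /(_ x Mx)]].
have Ax : A x.
  rewrite -AE; apply: commutantS Mx; apply: commutantS.
  by move=> y [].
split=> //; have [x' Ax' xx'] := star_adjoint starA Ax.
have [zeta zetaP] := normal_functional_bound starA (state_normal phiA).
have Aal := aut_in autA.
have AB a b : A a -> A b -> A (a - b) by exact: star_sub.
have Az : A (alpha x - x) by apply: AB => //; exact: Aal.
have Az' : A (alpha x' - x') by apply: AB => //; exact: Aal.
have zz' : adjoint_op (alpha x - x) (alpha x' - x').
  by apply: adjoint_opB => //; exact: (aut_adjoint autA).
apply/eqP; rewrite -subr_eq0; apply/eqP/(adjoint_comp_eq0 zz').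
have Az'z : A ((alpha x' - x') \o (alpha x - x)) by exact: star_comp.
apply: (state_faithful phiA) => //; first exact: positive_op_sq.
have phi0 := state_positive phiA Az'z (positive_op_sq zz').
suff : re (phi ((alpha x' - x') \o (alpha x - x))) <= 0.
  move=> le0; rewrite -[LHS](reK (ger0_real phi0)).
  by have -> : re (phi ((alpha x' - x') \o (alpha x - x))) = 0
    by apply/eqP; rewrite eq_le le0 re_ge0.
apply: (@small_le0 _ _ 4) => // e e0.
have [m [Am fm] xm] := bicommutant_density zeta starM (star_bounded starA Ax)
   (star_bounded starA Ax') xx' Mx e0.
have [m' [Am' fm'] mm'] := star_adjoint starM (conj Am fm).
have Aw := AB _ _ Ax Am; have Aw' := AB _ _ Ax' Am'.
have ww' := adjoint_opB xx' mm'.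
have alB y z : A y -> A z -> alpha (y - z) = alpha y - alpha z.
  exact: linear_onB (aut_linear autA).
have -> : alpha x - x = alpha (x - m) - (x - m).
  by rewrite alB// fm opprB addrA subrK.
have -> : alpha x' - x' = alpha (x' - m') - (x' - m').
  by rewrite alB// fm' opprB addrA subrK.
have := state_subM starA phiA (Aal _ Aw) (Aal _ Aw') Aw Aw'
  (aut_adjoint autA Aw Aw' ww') ww'.
rewrite -(aut_comp autA)// (aut_state autA); last exact: star_comp.
have := zetaP _ _ _ Aw Aw' ww' xm; lra.
Qed.

End FixedPoints.

(** * Braid relations and invariance of the tail algebra *)

Section Braid.

Lemma to_braid_cat u v : (to_braid u * to_braid v)%g = to_braid (u ++ v).
Proof. exact: braid_mulE. Qed.

Lemma sigma_braid i :
  (sigma i.+1 * sigma i.+2 * sigma i.+1 =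
   sigma i.+2 * sigma i.+1 * sigma i.+2)%g.
Proof.
rewrite /sigma /= !to_braid_cat.
exact/to_braidP/braid_eq_adjacent.
Qed.

Lemma sigma_commute i j : (i.+1 < j)%N ->
  (sigma i.+1 * sigma j.+1 = sigma j.+1 * sigma i.+1)%g.
Proof.
move=> ij; rewrite /sigma /= !to_braid_cat.
exact/to_braidP/braid_eq_distant.
Qed.

Lemma sigma_desc_commute m n : (n < m)%N ->
  (sigma m.+1 * sigma_desc n = sigma_desc n * sigma m.+1)%g.
Proof.
elim: n => [|n IH] nm; first by rewrite /= mulg1 mul1g.
rewrite [sigma_desc _]/= mulgA -sigma_commute// -!mulgA; congr (_ * _)%g.
by apply: IH; exact: ltn_trans nm.
Qed.

(** Sliding a generator through [sigma_k ... sigma_1] from left to right raises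
    its index by one: the braid relation does it where the word contains
    [sigma_(m+2) sigma_(m+1)], and the generator commutes with the other
    letters. *)
Lemma sigma_desc_shift m k : (m.+1 < k)%N ->
  (sigma m.+1 * sigma_desc k = sigma_desc k * sigma m.+2)%g.
Proof.
elim: k => // k IH; rewrite ltnS leq_eqVlt => /orP[/eqP <-|mk].
  rewrite [sigma_desc _]/= !mulgA sigma_braid -!mulgA; do 2 congr (_ * _)%g.
  exact: sigma_desc_commute.
rewrite [sigma_desc k.+1]/= mulgA sigma_commute// -!mulgA; congr (_ * _)%g.
exact: IH.
Qed.

Lemma to_braid_neg i : (to_braid [:: (i, false)] * sigma i.+1 = 1)%g.
Proof. by rewrite /sigma to_braid_cat; exact/to_braidP/braid_eq_cancel. Qed.

Lemma to_braid_cons l w : to_braid (l :: w) = (to_braid [:: l] * to_braid w)%g.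
Proof. by rewrite to_braid_cat. Qed.

End Braid.

Section BraidAction.
Context {R : realType} {H : hilbertSpace R}.
Variables (A : set (H -> H)) (phi : (H -> H) -> Cplx R).
Variable rho : braid_group -> (H -> H) -> (H -> H).
Hypothesis rhoA : braid_representation A phi rho.
Implicit Types (x : H -> H).

Lemma rho_in g x : A x -> A (rho g x).
Proof. exact: (aut_in (rhoA.1 g)). Qed.

Lemma rho1 x : A x -> rho 1%g x = x.
Proof.
move=> Ax; have [_ inj _] := aut_bij (rhoA.1 1%g).
by apply: inj; rewrite ?inE//; [exact: rho_in | rewrite -rhoA.2// mul1g].
Qed.

Lemma braid_fixed_sigma x : A x ->
  (forall m, rho (sigma m.+1) x = x) -> braid_fixed A rho x.
Proof.
move=> Ax fx; split=> // g; rewrite -(to_braid_repr g).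
elim: (repr g) => [|[i b] w IH]; first exact: rho1.
rewrite to_braid_cons rhoA.2// IH; case: b; first exact: fx.
by rewrite -{1}(fx i) -rhoA.2// to_braid_neg rho1.
Qed.

(** By the shift relation, [sigma (m + 1)] acts on the image of [x] under
    [sigma_k ... sigma_1] as [sigma (m + 2)] acts on [x], hence trivially since
    the index is at least 2. *)
Lemma braid_sequence_fixed x m k : A x -> braid_A0 A rho x -> (m.+1 < k)%N ->
  fixed_points A (rho (sigma m.+1)) (braid_sequence rho k x).
Proof.
move=> Ax A0x mk.
have -> : braid_sequence rho k x = rho (sigma_desc k) x by case: k mk.
split; first exact: rho_in.
rewrite -rhoA.2// sigma_desc_shift// rhoA.2//.
by have [_ ->] := A0x m.+2 isT.
Qed.

End BraidAction.

Section Generated.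
Context {R : realType} {H : hilbertSpace R}.

Lemma sub_vN_generated (S : set (H -> H)) : S `<=` vN_generated S.
Proof. by move=> x Sx N [_]; apply. Qed.

Lemma vN_generated_min (S N : set (H -> H)) :
  von_neumann_algebra N -> S `<=` N -> vN_generated S `<=` N.
Proof. by move=> vN SN x; apply. Qed.

End Generated.

Theorem theorem2p5 (R : realType) (H : hilbertSpace R)
    (A : set (H -> H)) (phi : (H -> H) -> Cplx R)
    (rho : braid_group -> (H -> H) -> (H -> H)) (C0 : set (H -> H))
    (probA : probability_space A phi)
    (rhoA : braid_representation A phi rho)
    (condC0 : conditioned A phi C0)
    (C0_sub : C0 `<=` braid_A0 A rho) :
  let C_tail := tail_algebra (braid_sequence rho) C0 in
  C_tail `<=` braid_fixed A rho /\
  (braid_fixed A rho `<=` C0 ->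
     C_tail = braid_fixed A rho /\
     (order_independent (braid_sequence rho) C0 phi ->
        C_tail = scalar_ops /\ braid_fixed A rho = scalar_ops)).
Proof.
move=> C_tail; have [vnA _ phiA] := probA; have starA := vnA.1.
have [_ C0A _] := condC0.
have tail_fixed : C_tail `<=` braid_fixed A rho.
  move=> x xtail.
  have fx m : fixed_points A (rho (sigma m.+1)) x.
    apply: vN_generated_min (xtail m.+2 I).
      exact: fixed_points_vN (rhoA.1 _).
    move=> _ [k /= mk [c C0c <-]].
    by apply: (braid_sequence_fixed rhoA) => //; [exact: C0A|exact: C0_sub].
  apply: (braid_fixed_sigma rhoA) => [|m]; first by have [] := fx 0%N.
  by have [] := fx m.
split=> // fixC0.
have fixed_gen x k : braid_fixed A rho x -> (braid_sequence rho k @` C0) x.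
  move=> fx; exists x; first exact: fixC0.
  by case: k => //= k; exact: fx.2.
have tailE : C_tail = braid_fixed A rho.
  apply/seteqP; split=> // x fx n _; apply: sub_vN_generated.
  by exists n; [exact: leqnn | exact: fixed_gen].
split=> // indep; suff fixE : braid_fixed A rho = scalar_ops by rewrite tailE.
apply/seteqP; split=> [x fx|_ [c _ <-]]; last first.
  split=> [|g]; first exact: star_scalar.
  by have [_ ->] := star_scalar (fixed_points_star starA (rhoA.1 g)) c.
have fixed_star g := fixed_points_star starA (rhoA.1 g).
pose y := (- phi x) *: idfun + x.
have fixg g : fixed_points A (rho g) y.
  apply: (star_linear (fixed_star g)); first exact: (star_id (fixed_star g)).
  by split; [exact: fx.1|exact: fx.2].
have fy : braid_fixed A rho y.
  by split=> [|g]; [have [] := fixg 1%g|have [] := fixg g].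
have [y' Ay' yy'] := star_adjoint starA fy.1.
have fy' : braid_fixed A rho y'.
  split=> // g; have [z [_ fz] yz] := star_adjoint (fixed_star g) (fixg g).
  by rewrite (adjoint_op_uniq yy' yz).
have phiy : phi y = 0.
  rewrite /y (state_linear phiA)//; [|exact: star_id starA|exact: fx.1].
  by rewrite (state_unit phiA) [_ *: _]mulr1 addNr.
have phiyy : phi (y' \o y) = 0.
  rewrite (indep [set 0%N] [set k | (1 <= k)%N]).
  - by rewrite phiy mulr0.
  - by left=> i j /= ->.
  - by apply: sub_vN_generated; exists 0%N => //; exact: fixed_gen.
  - by apply: sub_vN_generated; exists 1%N => //; exact: fixed_gen.
have y0 : y = 0.
  apply: (adjoint_comp_eq0 yy'); apply: (state_faithful phiA) => //.
    exact: star_comp Ay' fy.1.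
  exact: positive_op_sq.
exists (phi x) => //; apply/esym/eqP; rewrite -subr_eq0 addrC -scaleNr.
exact/eqP.
Qed.
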